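(* Let $\lambda,\mu>0$ with $\lambda\mu<4$, let $T:\mathcal H\to\mathcal H$ be a $\lambda$-relaxed cutter and $U:\mathcal H\to\mathcal H$ be a $\mu$-relaxed cutter with $\operatorname{Fix}T\cap\operatorname{Fix}U\neq\emptyset$, and let $\nu^*:=\frac{4(\lambda+\mu-\lambda\mu)}{4-\lambda\mu}$. Let $$\tau^*(x):=\frac{\|a_1+b_1\|^2}{\frac1\lambda\|a_1\|^2+\frac1\mu\|b_1\|^2+\langle a_1,b_1\rangle}\quad\text{if }x\notin\operatorname{Fix}T\cap\operatorname{Fix}U,\qquad\tau^*(x):=1\quad\text{otherwise},$$ where $a_1:=T(x)-x$ and $b_1:=UT(x)-T(x)$. Let the function $\tau:\mathcal H\to(0,+\infty)$ be such that $\tau^*(x)\le\tau(x)\le\nu^*$ for all $x\notin\operatorname{Fix}T\cap\operatorname{Fix}U$. Then the operator $UT$ is a generalized $\tau$-relaxed cutter; consequently, $(UT)_{1/\tau}$ is a cutter which is an extrapolation of the cutter $(UT)_{1/\nu^*}$. Moreover, if $T$ and $U$ satisfy the demi closedness principle, then $(UT)_{1/\tau}$ also satisfies the demi closedness principle.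
   Context: $\mathcal H$ is a real Hilbert space with $\mathcal H\neq\{0\}$; $UT$ denotes the composition $U\circ T$; $\operatorname{Fix}S:=\{z\in\mathcal H:S(z)=z\}$. For a function $\sigma:\mathcal H\to(0,+\infty)$ (in particular a positive constant), the generalized relaxation of an operator $S:\mathcal H\to\mathcal H$ is $S_\sigma(x):=x+\sigma(x)(S(x)-x)$. If $\sigma(x)\ge1$ for all $x\in\mathcal H$ and $\sigma(x)>1$ for at least one $x\notin\operatorname{Fix}S$, then $S_\sigma$ is called an extrapolation of $S$. An operator $S$ with $\operatorname{Fix}S\neq\emptyset$ is a cutter if $\langle z-x,S(x)-x\rangle\ge\|S(x)-x\|^2$ for all $x\in\mathcal H$ and $z\in\operatorname{Fix}S$. For $\lambda>0$, a $\lambda$-relaxed cutter is an operator of the form $C_\lambda$ with $C$ a cutter; equivalently, an operator $S$ with $\operatorname{Fix}S\neq\emptyset$ and $\lambda\langle z-x,S(x)-x\rangle\ge\|S(x)-x\|^2$ for all $x\in\mathcal H$, $z\in\operatorname{Fix}S$. A generalized $\tau$-relaxed cutter is an operator of the form $C_\tau$ with $C$ a cutter; equivalently, the last inequality holds with $\lambda$ replaced by $\tau(x)$. An operator $S$ satisfies the demi closedness principle if for any bounded sequence $\{x^k\}$ with $\|S(x^k)-x^k\|\to0$, every weak cluster point of $\{x^k\}$ belongs to $\operatorname{Fix}S$.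
   Formalization: The extrapolation claim fails if τ=ν* off Fix T∩Fix U (e.g. T=U=Id); proved instead: (UT)_{1/τ} is a relaxation of (UT)_{1/ν*} by some σ≥1, and a strict extrapolation exactly when τ(x)<ν* for some x∉Fix T∩Fix U. *)

(* Defs.v *)
From HB Require Import structures.
From mathcomp Require Import all_boot all_order all_algebra.
From mathcomp Require Import all_classical all_reals all_analysis.

Set Implicit Arguments.
Unset Strict Implicit.
Unset Printing Implicit Defensive.

Import Order.TTheory GRing.Theory Num.Theory.
Import numFieldNormedType.Exports.

Local Open Scope classical_set_scope.
Local Open Scope ring_scope.

(* A real Hilbert space is a complete normed module H over R together with a
   positive definite symmetric form whose square is the squared norm of H. *)
Definition hilbert_dot (R : realType) (H : completeNormedModType R)
    (dot : {dot H for @idfun R}) : Prop :=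
  forall x : H, `|x| ^+ 2 = dot x x.

Definition Fix (H : Type) (S : H -> H) : set H := [set z | S z = z].

Definition relax (R : realType) (H : completeNormedModType R)
    (S : H -> H) (sigma : H -> R) : H -> H :=
  fun x => x + sigma x *: (S x - x).

Definition extrapolation (R : realType) (H : completeNormedModType R)
    (S' S : H -> H) : Prop :=
  exists sigma : H -> R,
    [/\ forall x, 1 <= sigma x,
        exists2 x, ~ Fix S x & 1 < sigma x
      & S' = relax S sigma].

Definition cutter (R : realType) (H : completeNormedModType R)
    (dot : {dot H for @idfun R}) (S : H -> H) : Prop :=
  Fix S !=set0 /\
  forall x z, Fix S z -> `|S x - x| ^+ 2 <= dot (z - x) (S x - x).

(* For a constant tau := fun=> lambda these are the lambda-relaxed cutters.
   Positivity of tau is not part of the definition. *)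
Definition relaxed_cutter (R : realType) (H : completeNormedModType R)
    (dot : {dot H for @idfun R}) (tau : H -> R) (S : H -> H) : Prop :=
  exists2 C : H -> H, cutter dot C & S = relax C tau.

Definition weakly_cvg (R : realType) (H : completeNormedModType R)
    (dot : {dot H for @idfun R}) (x : nat -> H) (z : H) : Prop :=
  forall y : H, dot (x k) y @[k --> \oo] --> dot z y.

(* Sequential version; on bounded sequences of a Hilbert space it agrees with
   the cluster points for the weak topology. *)
Definition weak_cluster_point (R : realType) (H : completeNormedModType R)
    (dot : {dot H for @idfun R}) (x : nat -> H) (z : H) : Prop :=
  exists2 phi : nat -> nat, increasing_seq phi & weakly_cvg dot (x \o phi) z.

Definition demiclosedness_principle (R : realType)
    (H : completeNormedModType R) (dot : {dot H for @idfun R})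
    (S : H -> H) : Prop :=
  forall x : nat -> H, bounded_set (range x) ->
    `|S (x k) - x k| @[k --> \oo] --> (0 : R) ->
    forall z, weak_cluster_point dot x z -> Fix S z.

Definition nu_star (R : realType) (lambda mu : R) : R :=
  4 * (lambda + mu - lambda * mu) / (4 - lambda * mu).

Definition tau_star (R : realType) (H : completeNormedModType R)
    (dot : {dot H for @idfun R}) (lambda mu : R) (T U : H -> H) (x : H) : R :=
  let a := T x - x in
  let b := U (T x) - T x in
  if x \in Fix T `&` Fix U then 1
  else `|a + b| ^+ 2
       / (lambda^-1 * `|a| ^+ 2 + mu^-1 * `|b| ^+ 2 + dot a b).

(* Main.v *)
Require Import Defs.
From HB Require Import structures.
From mathcomp Require Import all_boot all_order all_algebra.
From mathcomp Require Import all_classical all_reals all_analysis.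
From mathcomp Require Import ring lra.

Set Implicit Arguments.
Unset Strict Implicit.
Unset Printing Implicit Defensive.

Import Order.TTheory GRing.Theory Num.Theory.
Import numFieldNormedType.Exports.

Local Open Scope classical_set_scope.
Local Open Scope ring_scope.

(** Write [a = T x - x] and [b = U (T x) - T x], so that the displacement of
    [U \o T] at [x] is [a + b].  Testing the inequalities of the relaxed cutters
    [T] (at [x]) and [U] (at [T x]) against a common fixed point [z] and adding
    them gives [gap_le_dot]:

      [gap a b = |a|^2 / lambda + |b|^2 / mu + dot a b <= dot (z - x) (a + b)].

    The condition [lambda * mu < 4] makes the quadratic form [gap] positive
    definite: completing the square, it dominates positive
    multiples of [|a|^2] and of [|b|^2] ([gap_gel], [gap_ger]).  Everything
    follows from these two facts.

    - If [U (T x) = x], the right-hand side vanishes, hence so do [a] and [b]: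
      the fixed points of [U \o T] are the common ones ([Fix_comp]).
    - Away from them [tau_star x = |a + b|^2 / gap a b], so that
      [|a + b|^2 <= tau x * gap a b <= tau x * dot (z - x) (a + b)] as soon as
      [tau_star x <= tau x] ([comp_relaxed_cutter]).  This applies to [tau] and
      to the constant [nu_star]; the ratio [nu_star / tau] is the extrapolation
      function between the two cutters.
    - On a bounded sequence whose displacements under [U \o T] vanish, the
      right-hand side tends to [0], hence so do the displacements of [T] along
      the sequence and of [U] along its image by [T].  The two sequences have
      the same weak cluster points, which are fixed by both operators
      ([comp_demiclosedness_principle]).  Relaxing by [1 / tau], which is
      bounded below by [1 / nu_star] off the fixed points, preserves this
      ([demiclosedness_principle_relax]). *)

(** * The inner product *)

Section InnerProduct.
Variables (R : realType) (H : completeNormedModType R).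
Variables (dot : {dot H for @idfun R}) (Hdot : hilbert_dot dot).
Implicit Types (u v w : H).

Lemma dotC u v : dot u v = dot v u.
Proof. by rewrite hermC /= expr0 mul1r. Qed.

Lemma dotDl u v w : dot (u + v) w = dot u w + dot v w.
Proof. by rewrite linearDl. Qed.

Lemma dotDr u v w : dot u (v + w) = dot u v + dot u w.
Proof. by rewrite linearDr. Qed.

Lemma dotZl c u v : dot (c *: u) v = c * dot u v.
Proof. by rewrite linearZl. Qed.

Lemma dotZr c u v : dot u (c *: v) = c * dot u v.
Proof. by rewrite linearZr. Qed.

Lemma normsqD u v : `|u + v| ^+ 2 = `|u| ^+ 2 + 2 * dot u v + `|v| ^+ 2.
Proof. by rewrite !Hdot dotDl !dotDr (dotC v u); ring. Qed.

Lemma normsqZ c u : `|c *: u| ^+ 2 = c ^+ 2 * `|u| ^+ 2.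
Proof. by rewrite normrZ exprMn real_normK ?num_real. Qed.

(** The expansion of the square of [|v| u - |u| v], which is nonnegative, is
    [2 |u| |v| (|u| |v| - dot u v)]. *)
Lemma cauchy_schwarz u v : `|dot u v| <= `|u| * `|v|.
Proof.
suff dot_le w w' : dot w w' <= `|w| * `|w'|.
  rewrite ler_norml dot_le andbT lerNl.
  by have := dot_le (- u) v; rewrite linearNl normrN.
have [w0|w_neq0] := eqVneq w 0; first by rewrite w0 linear0l normr0 mul0r.
have [w0|w'_neq0] := eqVneq w' 0; first by rewrite w0 linear0 normr0 mulr0.
have ww'_gt0 : 0 < `|w| * `|w'| by rewrite mulr_gt0 ?normr_gt0.
pose p := `|w|; pose q := `|w'|.
have : 0 <= `|q *: w + - p *: w'| ^+ 2 by exact: exprn_ge0.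
rewrite normsqD (normsqZ q w) (normsqZ (- p) w') sqrrN dotZl dotZr -/p -/q => sq_ge0.
rewrite -(ler_pM2l ww'_gt0) -subr_ge0 -(pmulr_rge0 _ (ltr0Sn R 1)) -/p -/q.
by apply: le_trans sq_ge0 _; rewrite le_eqVlt; apply/orP; left; apply/eqP; ring.
Qed.

End InnerProduct.

(** * Relaxations *)

Section Relaxation.
Variables (R : realType) (H : completeNormedModType R).
Implicit Types (S : H -> H) (s t : H -> R).

Lemma relax_relax S s t :
  relax (relax S s) t = relax S (fun x => t x * s x).
Proof. by apply/funext => x; rewrite /relax [x + _ - x]addrC addKr scalerA. Qed.

Lemma relax1 S : relax S (fun=> 1) = S.
Proof. by apply/funext => x; rewrite /relax scale1r addrC subrK. Qed.

Lemma relaxB S s x : relax S s x - x = s x *: (S x - x).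
Proof. by rewrite /relax [x + _]addrC addrK. Qed.

Lemma Fix_relax S s : (forall x, s x != 0) -> Fix (relax S s) = Fix S.
Proof.
move=> s_neq0; apply/seteqP; split=> x; rewrite /Fix /= => /eqP.
  by rewrite -subr_eq0 relaxB scaler_eq0 (negPf (s_neq0 x)) subr_eq0 => /eqP.
by move=> /eqP Sx; rewrite /relax Sx subrr scaler0 addr0.
Qed.

Variables (dot : {dot H for @idfun R}).

Lemma cutter_relaxV S t : (forall x, 0 < t x) ->
  relaxed_cutter dot t S <-> cutter dot (relax S (fun x => (t x)^-1)).
Proof.
move=> t_gt0; split=> [[C cutC ->]|cutS].
  rewrite relax_relax (_ : (fun x => _) = fun=> 1) ?relax1 //.
  by apply/funext => x; rewrite mulVf // gt_eqF.
exists (relax S (fun x => (t x)^-1)) => //.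
rewrite relax_relax (_ : (fun x => _) = fun=> 1) ?relax1 //.
by apply/funext => x; rewrite mulfV // gt_eqF.
Qed.

Lemma relaxed_cutterP S t : (forall x, 0 < t x) ->
  relaxed_cutter dot t S <->
  Fix S !=set0 /\ forall x z, Fix S z ->
    `|S x - x| ^+ 2 <= t x * dot (z - x) (S x - x).
Proof.
move=> t_gt0; have t_neq0 x : (t x)^-1 != 0 by rewrite invr_eq0 gt_eqF.
rewrite cutter_relaxV // /cutter Fix_relax //.
split=> -[FixS ineqS]; split=> // x z /(ineqS x z); rewrite relaxB normsqZ.
  rewrite dotZr expr2 -mulrA ler_pM2l ?invr_gt0 //.
  by rewrite mulrC ler_pdivrMr // [leRHS]mulrC.
move=> ineq; rewrite dotZr expr2 -mulrA ler_pM2l ?invr_gt0 //.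
by rewrite mulrC ler_pdivrMr // [leRHS]mulrC.
Qed.

End Relaxation.

(** * Composition of two relaxed cutters *)

Section Composition.
Variables (R : realType) (H : completeNormedModType R).
Variables (dot : {dot H for @idfun R}) (Hdot : hilbert_dot dot).

(** The denominator of [tau_star], as a quadratic form in the two successive
    displacements. *)
Definition gap (lambda mu : R) (a b : H) : R :=
  lambda^-1 * `|a| ^+ 2 + mu^-1 * `|b| ^+ 2 + dot a b.

Lemma gapC lambda mu a b : gap lambda mu a b = gap mu lambda b a.
Proof. by rewrite /gap (dotC dot a b); ring. Qed.

(** Completing the square in [b]: the difference of the two sides is
    [|b + (mu / 2) a|^2 / mu]. *)
Lemma gap_gel (lambda mu : R) (a b : H) : 0 < lambda -> 0 < mu ->
  (4 - lambda * mu) / (4 * lambda) * `|a| ^+ 2 <= gap lambda mu a b.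
Proof.
move=> l_gt0 m_gt0; rewrite -subr_ge0.
have -> : gap lambda mu a b - (4 - lambda * mu) / (4 * lambda) * `|a| ^+ 2
    = mu^-1 * `|b + (mu / 2) *: a| ^+ 2.
  rewrite (normsqD Hdot) normsqZ dotZr /gap (dotC dot b a).
  by field; rewrite ?gt_eqF.
by rewrite mulr_ge0 ?exprn_ge0 // invr_ge0 ltW.
Qed.

Lemma gap_ger (lambda mu : R) (a b : H) : 0 < lambda -> 0 < mu ->
  (4 - lambda * mu) / (4 * mu) * `|b| ^+ 2 <= gap lambda mu a b.
Proof. by move=> ? ?; rewrite gapC [lambda * mu]mulrC; exact: gap_gel. Qed.

Variables (lambda mu : R) (lambda_gt0 : 0 < lambda) (mu_gt0 : 0 < mu).
Variables (T U : H -> H).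
Hypotheses (HT : relaxed_cutter dot (fun=> lambda) T).
Hypotheses (HU : relaxed_cutter dot (fun=> mu) U).

(** Sum of the inequality of [T] at [x] and of the inequality of [U] at [T x];
    the term [dot a b] comes from replacing [z - T x] by [z - x] in the latter. *)
Lemma gap_le_dot x z : (Fix T `&` Fix U) z ->
  gap lambda mu (T x - x) (U (T x) - T x) <= dot (z - x) (U (T x) - x).
Proof.
move=> [Tz Uz].
have /relaxed_cutterP[//|_ /(_ x z Tz)] := HT.
have /relaxed_cutterP[//|_ /(_ (T x) z Uz)] := HU.
set a := T x - x; set b := U (T x) - T x => ineqU ineqT.
have -> : U (T x) - x = a + b by rewrite /a /b [RHS]addrC addrA subrK.
have splitU : dot (z - x) b = dot (z - T x) b + dot a b.
  by rewrite -dotDl /a addrA subrK.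
have leT : lambda^-1 * `|a| ^+ 2 <= dot (z - x) a.
  by rewrite mulrC ler_pdivrMr // mulrC.
have leU : mu^-1 * `|b| ^+ 2 <= dot (z - T x) b.
  by rewrite mulrC ler_pdivrMr // mulrC.
by rewrite /gap dotDr splitU; lra.
Qed.

(** This keeps the image of a bounded sequence bounded. *)
Lemma relaxed_cutter_displacement_le x z : Fix T z ->
  `|T x - x| <= lambda * `|z - x|.
Proof.
move=> Tz; have [->|a_neq0] := eqVneq (T x - x) 0.
  by rewrite normr0 mulr_ge0 // ltW.
rewrite -(@ler_pM2r _ `|T x - x|) ?normr_gt0 // -expr2.
have /relaxed_cutterP[//|_ /(_ x z Tz)] := HT; move=> /le_trans; apply.
rewrite -mulrA ler_pM2l //; apply: le_trans (ler_norm _) _.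
exact: cauchy_schwarz.
Qed.

Hypothesis lambda_mu_lt4 : lambda * mu < 4.

(** [lambda * mu < lambda + mu], since
    [(lambda * mu)^2 < 4 * lambda * mu <= (lambda + mu)^2]. *)
Lemma nu_star_gt0 : 0 < nu_star lambda mu.
Proof.
have lm_gt0 : 0 < lambda * mu by rewrite mulr_gt0.
rewrite /nu_star divr_gt0 ?subr_gt0 // mulr_gt0 // subr_gt0.
have : (lambda * mu) ^+ 2 < (lambda + mu) ^+ 2.
  have : (lambda * mu) ^+ 2 < 4 * (lambda * mu) by rewrite expr2 ltr_pM2r.
  have : 0 <= (lambda - mu) ^+ 2 by exact: sqr_ge0.
  nra.
by rewrite ltr_pXn2r // nnegrE ltW // addr_gt0.
Qed.

Lemma gap_eq0 (a b : H) : gap lambda mu a b <= 0 -> a = 0 /\ b = 0.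
Proof.
move=> gap_le0; split; apply/eqP; rewrite -normr_eq0 -sqrf_eq0 eq_le sqr_ge0 andbT.
  have := le_trans (gap_gel a b lambda_gt0 mu_gt0) gap_le0.
  by rewrite pmulr_rle0 // divr_gt0 ?subr_gt0 ?mulr_gt0.
have := le_trans (gap_ger a b lambda_gt0 mu_gt0) gap_le0.
by rewrite pmulr_rle0 // divr_gt0 ?subr_gt0 ?mulr_gt0.
Qed.

Hypothesis HTU : Fix T `&` Fix U !=set0.

(** At a fixed point of [U \o T] the upper bound [gap_le_dot] is [0]. *)
Lemma Fix_comp : Fix (U \o T) = Fix T `&` Fix U.
Proof.
apply/seteqP; split=> x; last by rewrite /Fix /= => -[-> ->].
rewrite {1}/Fix /= => UTx; have [z TUz] := HTU.
have := gap_le_dot x TUz; rewrite UTx subrr linear0r => /gap_eq0[/eqP + _].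
rewrite subr_eq0 => /eqP Tx; split=> //.
by move: UTx; rewrite Tx.
Qed.

(** Off the common fixed points [gap] is positive, so [tau_star x <= s x] means
    that [s x * gap] bounds the squared displacement; conclude by
    [gap_le_dot]. *)
Lemma comp_relaxed_cutter (s : H -> R) : (forall x, 0 < s x) ->
  (forall x, ~ (Fix T `&` Fix U) x -> tau_star dot lambda mu T U x <= s x) ->
  relaxed_cutter dot s (U \o T).
Proof.
move=> s_gt0 s_ge; apply/relaxed_cutterP => //; rewrite Fix_comp; split=> // x z TUz.
have [|TUx] := pselect ((Fix T `&` Fix U) x).
  by rewrite -Fix_comp /Fix /= => ->; rewrite subrr normr0 linear0r mulr0 expr0n.
have gap_gt0 : 0 < gap lambda mu (T x - x) (U (T x) - T x).
  rewrite ltNge; apply/negP => /gap_eq0[/eqP + /eqP].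
  rewrite !subr_eq0 => /eqP Tx /eqP UTx; apply: TUx.
  by split; [exact: Tx | move: UTx; rewrite Tx].
have := s_ge _ TUx; rewrite /tau_star memNset // [_ + _]addrC addrA subrK.
rewrite -/(gap lambda mu (T x - x) (U (T x) - T x)) ler_pdivrMr // => /le_trans.
by apply; rewrite ler_pM2l // gap_le_dot.
Qed.

End Composition.

(** * Demi-closedness *)

Section Demiclosedness.
Variables (R : realType) (H : completeNormedModType R).
Variables (dot : {dot H for @idfun R}) (Hdot : hilbert_dot dot).

Lemma bounded_seqP (x : nat -> H) :
  bounded_set (range x) <-> exists M, forall k, `|x k| <= M.
Proof.
split=> [/pinfty_ex_gt0[M _ xM]|[M xM]].
  by exists M => k; apply: xM; exists k.
exists M; split; first exact: num_real.
by move=> N /ltW MN _ [k _ <-]; apply: le_trans (xM k) MN.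
Qed.

(** A perturbation that vanishes in norm vanishes weakly, by Cauchy-Schwarz. *)
Lemma weakly_cvgD (x a : nat -> H) z : weakly_cvg dot x z ->
  `|a k| @[k --> \oo] --> (0 : R) -> weakly_cvg dot (fun k => x k + a k) z.
Proof.
move=> xz a0 y.
have ay0 : dot (a k) y @[k --> \oo] --> (0 : R).
  apply: norm_cvg0; apply: (@squeeze_cvgr _ _ _ _ (fun=> 0) (fun k => `|a k| * `|y|)).
  - by near=> k; rewrite normr_ge0 cauchy_schwarz.
  - exact: cvg_cst.
  - by rewrite -(mul0r `|y|); apply: cvgMr_tmp.
rewrite -[dot z y]addr0.
by under eq_fun do rewrite dotDl; apply: cvgD; [exact: xz | exact: ay0].
Unshelve. all: end_near. Qed.

Lemma norm_sqr_cvg0 (u : nat -> H) :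
  `|u k| ^+ 2 @[k --> \oo] --> (0 : R) -> `|u k| @[k --> \oo] --> (0 : R).
Proof.
move=> /cvgr0Pnorm_lt u2_0; apply/cvgr0Pnorm_lt => e e_gt0.
have u2_lt := u2_0 _ (exprn_gt0 2 e_gt0); near=> k.
rewrite normr_id -(@ltr_pXn2r _ 2) ?nnegrE ?(ltW e_gt0) //.
rewrite -[X in X < _]ger0_norm ?exprn_ge0 //.
by near: k; exact: u2_lt.
Unshelve. all: end_near. Qed.

Lemma increasing_seq_cvgy (phi : nat -> nat) : increasing_seq phi ->
  phi k @[k --> \oo] --> \oo.
Proof.
move=> phi_incr; have le_phi k : (k <= phi k)%N.
  elim: k => // k /leq_ltn_trans; apply; rewrite ltnNge.
  by rewrite -leEnat phi_incr ltnn.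
by move=> A [N _ NA]; exists N => // k /= Nk; apply/NA/(leq_trans Nk).
Qed.

Lemma weak_cluster_pointD (x a : nat -> H) z : weak_cluster_point dot x z ->
  `|a k| @[k --> \oo] --> (0 : R) ->
  weak_cluster_point dot (fun k => x k + a k) z.
Proof.
move=> [phi phi_incr xz] a0; exists phi => //.
apply: (@weakly_cvgD (x \o phi) (a \o phi)) => //.
exact: cvg_comp (increasing_seq_cvgy phi_incr) a0.
Qed.

(** The lower bound [c] on the relaxation function turns vanishing relaxed
    displacements into vanishing displacements of [S]; at fixed points of [S]
    both are zero, whatever the value of [s]. *)
Lemma demiclosedness_principle_relax (S : H -> H) (s : H -> R) c : 0 < c ->
  (forall x, 0 < s x) -> (forall x, ~ Fix S x -> c <= s x) ->
  demiclosedness_principle dot S -> demiclosedness_principle dot (relax S s).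
Proof.
move=> c_gt0 s_gt0 s_ge demiS x x_bnd disp0 z xz.
rewrite Fix_relax => [|y]; last by rewrite gt_eqF.
apply: demiS xz => //.
apply: (@squeeze_cvgr _ _ _ _ (fun=> 0) (fun k => c^-1 * `|relax S s (x k) - x k|)).
- near=> k; rewrite normr_ge0 relaxB normrZ gtr0_norm //=.
  have [Sx|/s_ge c_le] := pselect (Fix S (x k)).
    by rewrite Sx subrr normr0 !mulr0.
  by rewrite mulrA ler_peMl // mulrC ler_pdivlMr // mul1r.
- exact: cvg_cst.
- by rewrite -(mulr0 c^-1); apply: cvgMl_tmp.
Unshelve. all: end_near. Qed.

(** The sequence [g] of gaps is squeezed to [0] between the positive
    definiteness of [gap] and [gap_le_dot], whose right-hand side is at most a
    constant times the displacement. *)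
Lemma comp_demiclosedness_principle (lambda mu : R) (T U : H -> H) :
  0 < lambda -> 0 < mu -> lambda * mu < 4 ->
  relaxed_cutter dot (fun=> lambda) T -> relaxed_cutter dot (fun=> mu) U ->
  Fix T `&` Fix U !=set0 ->
  demiclosedness_principle dot T -> demiclosedness_principle dot U ->
  demiclosedness_principle dot (U \o T).
Proof.
move=> l_gt0 m_gt0 lm_lt4 HT HU HTU demiT demiU x x_bnd disp0 z xz.
have [w [Tw Uw]] := HTU.
have /bounded_seqP[M xM] := x_bnd.
have wxM k : `|w - x k| <= `|w| + M.
  by apply: le_trans (ler_normB _ _) _; rewrite lerD2l.
pose g k := gap dot lambda mu (T (x k) - x k) (U (T (x k)) - T (x k)).
have g_le k : g k <= (`|w| + M) * `|U (T (x k)) - x k|.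
  apply: le_trans (gap_le_dot l_gt0 m_gt0 HT HU _ (conj Tw Uw)) _.
  apply: le_trans (ler_norm _) _; apply: le_trans (cauchy_schwarz Hdot _ _) _.
  by rewrite ler_wpM2r.
have sqr_cvg0 (u : nat -> H) c : 0 < c ->
    (forall k, c * `|u k| ^+ 2 <= g k) -> `|u k| @[k --> \oo] --> (0 : R).
  move=> c_gt0 u_le.
  have u2_0 : `|u k| ^+ 2 @[k --> \oo] --> (0 : R).
    apply: (@squeeze_cvgr _ _ _ _ (fun=> 0)
      (fun k => c^-1 * ((`|w| + M) * `|U (T (x k)) - x k|))).
    - near=> k; rewrite exprn_ge0 //= ler_pdivlMl //.
      exact: le_trans (u_le k) (g_le k).
    - exact: cvg_cst.
    - rewrite -(mulr0 c^-1) -(mulr0 (`|w| + M)).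
      by apply: cvgMl_tmp; apply: cvgMl_tmp.
  exact: norm_sqr_cvg0.
have c_gt0 t : 0 < t -> 0 < (4 - lambda * mu) / (4 * t).
  by move=> t_gt0; rewrite divr_gt0 ?subr_gt0 ?mulr_gt0.
have a0 : `|T (x k) - x k| @[k --> \oo] --> (0 : R).
  by apply: sqr_cvg0 (c_gt0 _ l_gt0) _ => k; exact: gap_gel.
have b0 : `|U (T (x k)) - T (x k)| @[k --> \oo] --> (0 : R).
  by apply: sqr_cvg0 (c_gt0 _ m_gt0) _ => k; exact: gap_ger.
rewrite (Fix_comp Hdot l_gt0 m_gt0 HT HU lm_lt4 HTU).
split; first exact: demiT a0 _ xz.
apply: (demiU (T \o x)) => //.
  apply/bounded_seqP; exists (M + lambda * (`|w| + M)) => k /=.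
  rewrite -[T (x k)](subrK (x k)) addrC; apply: le_trans (ler_normD _ _) _.
  rewrite lerD //; apply: le_trans (relaxed_cutter_displacement_le Hdot l_gt0 HT _ Tw) _.
  by rewrite ler_pM2l.
have := weak_cluster_pointD xz a0.
by congr (weak_cluster_point dot _ z); apply/funext => k /=; rewrite addrC subrK.
Unshelve. all: end_near. Qed.

End Demiclosedness.

(** * The extrapolated composition *)

Theorem corollary3p15 (R : realType) (H : completeNormedModType R)
    (dot : {dot H for @idfun R}) (Hdot : hilbert_dot dot)
    (Hnontrivial : exists x : H, x != 0)
    (lambda mu : R) (lambda_gt0 : 0 < lambda) (mu_gt0 : 0 < mu)
    (lambda_mu_lt4 : lambda * mu < 4)
    (T U : H -> H)
    (HT : relaxed_cutter dot (fun=> lambda) T)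
    (HU : relaxed_cutter dot (fun=> mu) U)
    (HTU : Fix T `&` Fix U !=set0)
    (tau : H -> R) (tau_gt0 : forall x, 0 < tau x)
    (Htau : forall x, ~ (Fix T `&` Fix U) x ->
       tau_star dot lambda mu T U x <= tau x <= nu_star lambda mu) :
  let UT_tau := relax (U \o T) (fun x => (tau x)^-1) in
  let UT_nu := relax (U \o T) (fun=> (nu_star lambda mu)^-1) in
  relaxed_cutter dot tau (U \o T) /\
  cutter dot UT_tau /\
  cutter dot UT_nu /\
  (exists2 sigma : H -> R,
     forall x, 1 <= sigma x & UT_tau = relax UT_nu sigma) /\
  (extrapolation UT_tau UT_nu <->
     exists2 x, ~ (Fix T `&` Fix U) x & tau x < nu_star lambda mu) /\
  (demiclosedness_principle dot T -> demiclosedness_principle dot U ->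
     demiclosedness_principle dot UT_tau).
Proof.
move=> UT_tau UT_nu.
have nu_gt0 := nu_star_gt0 lambda_gt0 mu_gt0 lambda_mu_lt4.
have FixUT := Fix_comp Hdot lambda_gt0 mu_gt0 HT HU lambda_mu_lt4 HTU.
have relaxed_UT s :=
  comp_relaxed_cutter Hdot lambda_gt0 mu_gt0 HT HU lambda_mu_lt4 HTU (s := s).
have UT_tauP : relaxed_cutter dot tau (U \o T).
  by apply: relaxed_UT => // x /Htau /andP[].
have UT_nuP : relaxed_cutter dot (fun=> nu_star lambda mu) (U \o T).
  by apply: relaxed_UT => // x /Htau /andP[]; exact: le_trans.
have Fix_nu : Fix UT_nu = Fix T `&` Fix U.
  by rewrite -FixUT Fix_relax // => x; rewrite invr_eq0 gt_eqF.
(* At common fixed points [tau] may exceed [nu_star]; the displacement is zero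
   there, so the extrapolation function may be set to [1]. *)
pose sigma x := if x \in Fix T `&` Fix U then 1 else nu_star lambda mu / tau x.
have sigma_ge1 x : 1 <= sigma x.
  rewrite /sigma; case: ifPn => // /negP; rewrite inE => /Htau /andP[_ tau_le].
  by rewrite ler_pdivlMr // mul1r.
have UT_tauE : UT_tau = relax UT_nu sigma.
  rewrite /UT_nu relax_relax; apply/funext => x; rewrite /UT_tau /relax /sigma.
  case: ifPn => [/set_mem|_].
    by rewrite -FixUT => ->; rewrite subrr !scaler0.
  by congr (_ + _ *: _); rewrite mulrAC mulfV ?mul1r // gt_eqF.
split=> //; split; first exact/cutter_relaxV.
split; first exact/(cutter_relaxV _ _ (fun=> nu_gt0)).
split; first by exists sigma.
split.
  split=> [[s [s_ge1 [x]]]|[x TUx tau_lt]]; last first.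
    exists sigma; split=> //; exists x; first by rewrite Fix_nu.
    by rewrite /sigma memNset // ltr_pdivlMr // mul1r.
  (* The displacement at [x] is nonzero, so the two representations of [UT_tau]
     have the same coefficient: [1 / tau x = s x / nu_star]. *)
  rewrite Fix_nu => TUx s_gt1 UT_tauE'; exists x => //.
  have d_neq0 : (U \o T) x - x != 0.
    by rewrite subr_eq0; apply/eqP => UTx; apply: TUx; rewrite -FixUT.
  have := congr1 (fun S => S x - x) UT_tauE'.
  rewrite /UT_nu relax_relax !relaxB => /eqP.
  rewrite -subr_eq0 -scalerBl scaler_eq0 (negPf d_neq0) orbF subr_eq0 => /eqP eq_s.
  by rewrite -ltf_pV2 ?posrE // eq_s -ltr_pdivrMr ?invr_gt0 // mulfV // gt_eqF ?invr_gt0.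
move=> demiT demiU; have demiUT := comp_demiclosedness_principle Hdot lambda_gt0
  mu_gt0 lambda_mu_lt4 HT HU HTU demiT demiU.
apply: (@demiclosedness_principle_relax _ _ _ _ _ (nu_star lambda mu)^-1) demiUT.
- by rewrite invr_gt0.
- by move=> x; rewrite invr_gt0.
- by move=> x; rewrite FixUT => /Htau /andP[_ tau_le]; rewrite lef_pV2 ?posrE.
Qed.
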